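(* Let $C=(C_\bullet,b,B)$ be a quasi-mixed complex of $k$-modules. Then the para-$S$-module $C^\natural=(C^\natural_\bullet,b+Bu^{-1},u^{-1},T)$ is a quasi-$S$-module.
   Context: $k$ is a unital ring, not assumed commutative; $k$-modules are left modules. A para-$S$-module $(C_\bullet,d,S,T)$ consists of $k$-modules $C_m$ ($m\ge 0$), $k$-linear maps $d:C_\bullet\to C_{\bullet-1}$, $S:C_\bullet\to C_{\bullet-2}$ and a $k$-linear isomorphism $T:C_\bullet\to C_\bullet$ such that $d^2=S(1-T)$ and $d,S,T$ commute pairwise. Then $\operatorname{ran}(1-T)$, with the induced operators, is again a para-$S$-module. A para-$S$-module is $S$-contractible if there is a $k$-linear map $\beta$ of degree $+1$ commuting with $S$ and $T$ such that $d\beta+\beta d=1$. A quasi-$S$-module is a para-$S$-module $(C_\bullet,d,S,T)$ such that $\operatorname{ran}(1-T)$ is $S$-contractible and $C_\bullet=\ker(1-T)\oplus\operatorname{ran}(1-T)$. A parachain complex $(C_\bullet,b,B)$ consists of $k$-modules $C_m$ ($m\ge0$) and $k$-linear maps $b:C_\bullet\to C_{\bullet-1}$, $B:C_\bullet\to C_{\bullet+1}$ with $b^2=0$, $B^2=0$, such that $T:=1-(bB+Bb)$ is an isomorphism. It is a quasi-mixed complex if $C_\bullet=\ker(1-T)\oplus\operatorname{ran}(1-T)$. For a parachain complex, $C^\natural_m=\bigoplus_{p\ge0,\,2p\le m}C_{m-2p}u^p$, where $u$ is a formal variable; $u^{-1}(xu^p)=xu^{p-1}$ for $p\ge1$ and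 $u^{-1}(xu^0)=0$; $b,B,T$ act on coefficients. Then $C^\natural=(C^\natural_\bullet,b+Bu^{-1},u^{-1},T)$ is a para-$S$-module. *)

(* Defs.v *)
From HB Require Import structures.
From mathcomp Require Import all_boot all_order all_algebra.
From mathcomp Require Import boolp.

Set Implicit Arguments.
Unset Strict Implicit.
Unset Printing Implicit Defensive.

Import GRing.Theory.
Local Open Scope ring_scope.

(* Graded modules are indexed by nat, with the convention that the component  *)
(* of every negative degree is 0.  An operator of degree -r is a family of    *)
(* linear maps C (m + r) -> C m (it vanishes on C 0, ..., C (r - 1)), so that *)
(* an identity between operators with values in negative degrees is void.     *)

Section Endomorphisms.

Variables (k : pzRingType) (V : lmodType k).

(* The image of 1 - T, as a submodule of V. *)
Definition in_ran (T : {linear V -> V}) : {pred V} :=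
  fun x => `[< exists y, x = y - T y >].

Lemma in_ranP (T : {linear V -> V}) x :
  reflect (exists y, x = y - T y) (x \in in_ran T).
Proof. exact: asboolP. Qed.

Lemma in_ran_submod (T : {linear V -> V}) : submod_closed (in_ran T).
Proof.
split; first by apply/in_ranP; exists 0; rewrite linear0 subr0.
move=> a _ _ /in_ranP[x ->] /in_ranP[y ->]; apply/in_ranP.
by exists (a *: x + y); rewrite linearP scalerBr opprD addrACA.
Qed.

HB.instance Definition _ (T : {linear V -> V}) :=
  GRing.isSubmodClosed.Build k V (in_ran T) (in_ran_submod T).

Definition ran (T : {linear V -> V}) : Type := {x : V | x \in in_ran T}.

HB.instance Definition _ (T : {linear V -> V}) := SubChoice.on (ran T).
HB.instance Definition _ (T : {linear V -> V}) :=
  [SubChoice_isSubLmodule of ran T by <:].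

(* V is the internal direct sum of ker (1 - T) and ran (1 - T). *)
Definition ker_ran_decomposition (T : {linear V -> V}) : Prop :=
  (forall x : V, exists y z : V,
     [/\ x = y + z, y - T y = 0 & z \in in_ran T]) /\
  (forall x : V, x - T x = 0 -> x \in in_ran T -> x = 0).

End Endomorphisms.

Record paraS (k : pzRingType) := ParaS {
  paraS_mod :> nat -> lmodType k;
  paraS_d : forall m, {linear paraS_mod m.+1 -> paraS_mod m};
  paraS_S : forall m, {linear paraS_mod m.+2 -> paraS_mod m};
  paraS_T : forall m, {linear paraS_mod m -> paraS_mod m};
  paraS_T_bij : forall m, bijective (paraS_T m);
  paraS_dd : forall m x, paraS_d m (paraS_d m.+1 x) =
                         paraS_S m (x - paraS_T m.+2 x);
  paraS_dS : forall m x, paraS_d m (paraS_S m.+1 x) =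
                         paraS_S m (paraS_d m.+2 x);
  paraS_dT : forall m x, paraS_d m (paraS_T m.+1 x) =
                         paraS_T m (paraS_d m x);
  paraS_ST : forall m x, paraS_S m (paraS_T m.+2 x) =
                         paraS_T m (paraS_S m x)
}.

(* In low degrees S vanishes on C 0 and C 1, and d on C 0; hence the first    *)
(* clauses of S_contraction_S (S beta = beta S on C 1) and of                 *)
(* S_contraction_homotopy (d beta + beta d = 1 on C 0).  On C 0 the identity  *)
(* S beta = beta S takes values in degree -1.                                 *)
Record S_contraction (k : pzRingType) (C : paraS k)
    (beta : forall m, {linear C m -> C m.+1}) : Prop := {
  S_contraction_S :
    (forall x : C 1, paraS_S C 0 (beta 1 x) = 0) /\
    (forall m (x : C m.+2),
       paraS_S C m.+1 (beta m.+2 x) = beta m (paraS_S C m x));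
  S_contraction_T : forall m (x : C m),
    paraS_T C m.+1 (beta m x) = beta m (paraS_T C m x);
  S_contraction_homotopy :
    (forall x : C 0, paraS_d C 0 (beta 0 x) = x) /\
    (forall m (x : C m.+1),
       paraS_d C m.+1 (beta m.+1 x) + beta m (paraS_d C m x) = x)
}.

Definition S_contractible (k : pzRingType) (C : paraS k) : Prop :=
  exists beta : forall m, {linear C m -> C m.+1}, S_contraction beta.

(* A linear map commuting with T induces a linear map on ran (1 - T). *)
Section InducedMap.

Variables (k : pzRingType) (U V : lmodType k).
Variables (TU : {linear U -> U}) (TV : {linear V -> V}) (f : {linear U -> V}).
Hypothesis fT : forall x, f (TU x) = TV (f x).

Fact ran_map_subproof (x : ran TU) : f (val x) \in in_ran TV.
Proof.
have /in_ranP[y ->] := valP x.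
by apply/in_ranP; exists (f y); rewrite linearB /= fT.
Qed.

Definition ran_map_fun (x : ran TU) : ran TV :=
  exist _ (f (val x)) (ran_map_subproof x).

Fact ran_map_linear : linear ran_map_fun.
Proof. by move=> a x y; apply: val_inj; rewrite /= linearP. Qed.

HB.instance Definition _ :=
  GRing.isLinear.Build k (ran TU) (ran TV) *:%R ran_map_fun ran_map_linear.

Definition ran_map : {linear ran TU -> ran TV} := ran_map_fun.

End InducedMap.

Section RanParaS.

Variables (k : pzRingType) (C : paraS k).

Definition ran_mod (m : nat) : lmodType k := ran (paraS_T C m).

Definition ran_d m : {linear ran_mod m.+1 -> ran_mod m} :=
  ran_map (@paraS_dT k C m).
Definition ran_S m : {linear ran_mod m.+2 -> ran_mod m} :=
  ran_map (@paraS_ST k C m).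
Definition ran_T m : {linear ran_mod m -> ran_mod m} :=
  ran_map (fun x => erefl (paraS_T C m (paraS_T C m x))).

Fact ran_T_bij m : bijective (ran_T m).
Proof.
have [g gK Kg] := paraS_T_bij C m.
have g_ran (x : ran (paraS_T C m)) : g (val x) \in in_ran (paraS_T C m).
  have /in_ranP[y ->] := valP x; apply/in_ranP; exists (g y).
  by apply: (can_inj gK); rewrite Kg linearB /= Kg.
exists (fun x : ran_mod m => exist _ (g (val x)) (g_ran x) : ran_mod m) => x;
  apply: val_inj => /=; [exact: gK | exact: Kg].
Qed.

Fact ran_dd m x : ran_d m (ran_d m.+1 x) = ran_S m (x - ran_T m.+2 x).
Proof. by apply: val_inj; rewrite /= paraS_dd. Qed.

Fact ran_dS m x : ran_d m (ran_S m.+1 x) = ran_S m (ran_d m.+2 x).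
Proof. by apply: val_inj; rewrite /= paraS_dS. Qed.

Fact ran_dT m x : ran_d m (ran_T m.+1 x) = ran_T m (ran_d m x).
Proof. by apply: val_inj; rewrite /= paraS_dT. Qed.

Fact ran_ST m x : ran_S m (ran_T m.+2 x) = ran_T m (ran_S m x).
Proof. by apply: val_inj; rewrite /= paraS_ST. Qed.

Definition ran_paraS : paraS k := ParaS ran_T_bij ran_dd ran_dS ran_dT ran_ST.

End RanParaS.

Definition quasi_S (k : pzRingType) (C : paraS k) : Prop :=
  S_contractible (ran_paraS C) /\
  (forall m, ker_ran_decomposition (paraS_T C m)).

(* T = 1 - (b B + B b); the term B b vanishes in degree 0. *)
Section ParachainT.

Variables (k : pzRingType) (C : nat -> lmodType k).
Variables (b : forall m, {linear C m.+1 -> C m}).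
Variables (B : forall m, {linear C m -> C m.+1}).

Definition parachain_T_fun (m : nat) : C m -> C m :=
  match m with
  | 0 => fun x => x - b 0 (B 0 x)
  | n.+1 => fun x => x - (b n.+1 (B n.+1 x) + B n (b n x))
  end.

Fact parachain_T_linear m : linear (@parachain_T_fun m).
Proof.
case: m => [|m] a x y /=; rewrite !(linearP (B _)) !(linearP (b _)).
  by rewrite scalerBr opprD addrACA.
rewrite (linearP (B _)) [X in _ - X]addrACA -scalerDr.
by rewrite scalerBr opprD addrACA.
Qed.

HB.instance Definition _ m :=
  GRing.isLinear.Build k (C m) (C m) *:%R (@parachain_T_fun m)
    (@parachain_T_linear m).

Definition parachain_T m : {linear C m -> C m} := @parachain_T_fun m.

End ParachainT.

Record parachain (k : pzRingType) := Parachain {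
  parachain_mod :> nat -> lmodType k;
  parachain_b : forall m, {linear parachain_mod m.+1 -> parachain_mod m};
  parachain_B : forall m, {linear parachain_mod m -> parachain_mod m.+1};
  parachain_bb : forall m x, parachain_b m (parachain_b m.+1 x) = 0;
  parachain_BB : forall m x, parachain_B m.+1 (parachain_B m x) = 0;
  parachain_T_bij : forall m, bijective (parachain_T parachain_b parachain_B m)
}.

Definition quasi_mixed (k : pzRingType) (C : parachain k) : Prop :=
  forall m, ker_ran_decomposition
              (parachain_T (parachain_b C) (parachain_B C) m).

(* The direct sum of the C (m - 2p) u^p over p with 2p <= m.  To avoid        *)
(* transport along m - 2p, the p-th summand is recorded as C n for the unique *)
(* n with n + 2p = m: an element x maps p, n and a proof of n + 2p = m to the *)
(* coefficient of u^p in x.  The index set is finite, so that the direct sum  *)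
(* is the set of all such families.                                           *)
Section UPolynomials.

Variables (k : pzRingType) (C : nat -> lmodType k) (m : nat).

Definition u_poly : Type := forall p n : nat, (n + p.*2)%N = m -> C n.

Implicit Types x y z : u_poly.

Lemma u_polyP x y : (forall p n e, x p n e = y p n e) <-> x = y.
Proof.
split=> [xy|-> //].
by apply: functional_extensionality_dep => p;
  apply: functional_extensionality_dep => n;
  apply: functional_extensionality_dep => e.
Qed.

HB.instance Definition _ := gen_eqMixin u_poly.
HB.instance Definition _ := gen_choiceMixin u_poly.

Definition u_poly0 : u_poly := fun p n e => 0.
Definition u_polyN x : u_poly := fun p n e => - x p n e.
Definition u_polyD x y : u_poly := fun p n e => x p n e + y p n e.
Definition u_polyZ (a : k) x : u_poly := fun p n e => a *: x p n e.

Fact u_polyDA : associative u_polyD.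
Proof. by move=> x y z; apply/u_polyP => p n e; apply: addrA. Qed.
Fact u_polyDC : commutative u_polyD.
Proof. by move=> x y; apply/u_polyP => p n e; apply: addrC. Qed.
Fact u_poly0D : left_id u_poly0 u_polyD.
Proof. by move=> x; apply/u_polyP => p n e; apply: add0r. Qed.
Fact u_polyND : left_inverse u_poly0 u_polyN u_polyD.
Proof. by move=> x; apply/u_polyP => p n e; apply: addNr. Qed.

HB.instance Definition _ :=
  GRing.isZmodule.Build u_poly u_polyDA u_polyDC u_poly0D u_polyND.

Fact u_polyZA a c x : u_polyZ a (u_polyZ c x) = u_polyZ (a * c) x.
Proof. by apply/u_polyP => p n e; apply: scalerA. Qed.
Fact u_poly1Z : left_id 1 u_polyZ.
Proof. by move=> x; apply/u_polyP => p n e; apply: scale1r. Qed.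
Fact u_polyZDr : right_distributive u_polyZ +%R.
Proof. by move=> a x y; apply/u_polyP => p n e; apply: scalerDr. Qed.
Fact u_polyZDl x : {morph u_polyZ^~ x : a c / a + c}.
Proof. by move=> a c; apply/u_polyP => p n e; apply: scalerDl. Qed.

HB.instance Definition _ :=
  GRing.Zmodule_isLmodule.Build k u_poly u_polyZA u_poly1Z u_polyZDr u_polyZDl.

Lemma u_polyDE x y p n e : (x + y) p n e = x p n e + y p n e.
Proof. by []. Qed.
Lemma u_polyNE x p n e : (- x) p n e = - x p n e.
Proof. by []. Qed.
Lemma u_polyZE a x p n e : (a *: x) p n e = a *: x p n e.
Proof. by []. Qed.

End UPolynomials.

Section Natural.

Variables (k : pzRingType) (C : parachain k).

Local Notation b := (parachain_b C).
Local Notation B := (parachain_B C).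
Local Notation T := (parachain_T b B).

Definition nat_mod (m : nat) : lmodType k := u_poly C m.

Fact degS p n m : (n + p.*2 = m)%N -> (n.+1 + p.*2 = m.+1)%N.
Proof. by move=> <-. Qed.

Fact degU p n m : (n + p.*2 = m)%N -> (n + p.+1.*2 = m.+2)%N.
Proof. by move=> <-; rewrite doubleS !addnS. Qed.

Fact degSU p n m : (n.+1 + p.*2 = m)%N -> (n + p.+1.*2 = m.+1)%N.
Proof. by move=> <-; rewrite doubleS !addnS. Qed.

(* The coefficient of u^p in (b + B u^-1) x is b x_p + B x_(p+1), where       *)
(* x_(p+1) lies in degree n - 1 if b x_p lies in degree n; the second term is *)
(* absent for n = 0.                                                          *)
Definition nat_d_fun m (x : nat_mod m.+1) : nat_mod m := fun p n =>
  match n return (n + p.*2)%N = m -> C n with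
  | 0 => fun e => b 0 (x p 1 (degS e))
  | n'.+1 => fun e => b n'.+1 (x p n'.+2 (degS e)) + B n' (x p.+1 n' (degSU e))
  end.

(* The coefficient of u^p in u^-1 x is x_(p+1). *)
Definition nat_S_fun m (x : nat_mod m.+2) : nat_mod m :=
  fun p n e => x p.+1 n (degU e).

Definition nat_T_fun m (x : nat_mod m) : nat_mod m :=
  fun p n e => T n (x p n e).

Fact nat_d_linear m : linear (@nat_d_fun m).
Proof.
move=> a x y; apply/u_polyP => p [|n] e; rewrite u_polyDE u_polyZE /=.
  by rewrite u_polyDE u_polyZE linearP.
by rewrite !u_polyDE !u_polyZE !linearP scalerDr addrACA.
Qed.

Fact nat_S_linear m : linear (@nat_S_fun m).
Proof. by []. Qed.

Fact nat_T_linear m : linear (@nat_T_fun m).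
Proof.
move=> a x y; apply/u_polyP => p n e.
by rewrite u_polyDE u_polyZE /nat_T_fun u_polyDE u_polyZE linearP.
Qed.

HB.instance Definition _ m := GRing.isLinear.Build k (nat_mod m.+1) (nat_mod m)
  *:%R (@nat_d_fun m) (@nat_d_linear m).
HB.instance Definition _ m := GRing.isLinear.Build k (nat_mod m.+2) (nat_mod m)
  *:%R (@nat_S_fun m) (@nat_S_linear m).
HB.instance Definition _ m := GRing.isLinear.Build k (nat_mod m) (nat_mod m)
  *:%R (@nat_T_fun m) (@nat_T_linear m).

Definition nat_d m : {linear nat_mod m.+1 -> nat_mod m} := @nat_d_fun m.
Definition nat_S m : {linear nat_mod m.+2 -> nat_mod m} := @nat_S_fun m.
Definition nat_T m : {linear nat_mod m -> nat_mod m} := @nat_T_fun m.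

Lemma parachain_bT m (x : C m.+1) : b m (T m.+1 x) = T m (b m x).
Proof.
case: m x => [|m] x; rewrite /= linearB linearD /= !parachain_bb add0r //.
by rewrite linear0 addr0.
Qed.

Lemma parachain_BT m (x : C m) : B m (T m x) = T m.+1 (B m x).
Proof.
case: m x => [|m] x; rewrite /= linearB /= ?linearD /= !parachain_BB ?linear0.
  by rewrite add0r.
by rewrite addr0 add0r.
Qed.

Fact nat_T_bij m : bijective (nat_T m).
Proof.
have inv n : exists g : C n -> C n, cancel (T n) g /\ cancel g (T n).
  by have [g gK Kg] := parachain_T_bij C n; exists g.
pose g n := projT1 (cid (inv n)).
have gK n : cancel (T n) (g n) by case: (projT2 (cid (inv n))).
have Kg n : cancel (g n) (T n) by case: (projT2 (cid (inv n))).
exists (fun (x : nat_mod m) => (fun p n e => g n (x p n e)) : nat_mod m) => x;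
  apply/u_polyP => p n e; [exact: gK | exact: Kg].
Qed.

Fact nat_dd m x : nat_d m (nat_d m.+1 x) = nat_S m (x - nat_T m.+2 x).
Proof.
apply/u_polyP => p n e.
have -> : nat_S m (x - nat_T m.+2 x) p n e =
    x p.+1 n (degU e) - T n (x p.+1 n (degU e)) by [].
case: n e => [|[|n]] e /=.
- rewrite (linearD (b _)) parachain_bb add0r subKr.
  by rewrite (eq_irrelevance (degSU (degS e)) (degU e)).
- rewrite (linearD (b _)) parachain_bb add0r subKr.
  by rewrite (eq_irrelevance (degSU (degS e)) (degU e))
             (eq_irrelevance (degS (degSU e)) (degU e)).
rewrite (linearD (b _)) (linearD (B _)) parachain_bb parachain_BB add0r addr0.
rewrite subKr.
by rewrite (eq_irrelevance (degSU (degS e)) (degU e))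
           (eq_irrelevance (degS (degSU e)) (degU e)).
Qed.

Fact nat_dS m x : nat_d m (nat_S m.+1 x) = nat_S m (nat_d m.+2 x).
Proof.
apply/u_polyP => p [|n] e; rewrite /= /nat_S_fun /=.
  by rewrite (eq_irrelevance (degU (degS e)) (degS (degU e))).
by rewrite (eq_irrelevance (degU (degS e)) (degS (degU e)))
           (eq_irrelevance (degU (degSU e)) (degSU (degU e))).
Qed.

Fact nat_dT m x : nat_d m (nat_T m.+1 x) = nat_T m (nat_d m x).
Proof.
apply/u_polyP => p [|n] e.
  exact: parachain_bT.
have -> : nat_T m (nat_d m x) p n.+1 e = T n.+1
  (b n.+1 (x p n.+2 (degS e)) + B n (x p.+1 n (degSU e))) by [].
by rewrite linearD -parachain_bT -parachain_BT.
Qed.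

Fact nat_ST m x : nat_S m (nat_T m.+2 x) = nat_T m (nat_S m x).
Proof. by []. Qed.

Definition natural : paraS k := ParaS nat_T_bij nat_dd nat_dS nat_dT nat_ST.

End Natural.

(* Main.v *)
Require Import Defs.
From mathcomp Require Import all_boot all_order all_algebra.
From HB Require Import structures.
From mathcomp Require Import boolp.

Import GRing.Theory.

(** Write N = 1 - T = bB + Bb.  On the range R of N, the decomposition of C
    into ker N and R makes N invertible, and N^-1 commutes with b and B since
    N does.  On the range,
      (b + Bu^-1) N^-1 B + N^-1 B (b + Bu^-1) = N^-1 (bB + Bb) = 1,
    because B^2 = 0.  So the map beta = N^-1 B, acting on coefficients,
    contracts the range of 1 - T in the complex of polynomials in u.  It respects the
    powers of u, so it commutes with u^-1.

    To avoid an operator that is only defined on R, N^-1 is extended by 0 on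
    ker N.  This extension is the group inverse of N (characterised
    by [group_inverse_ran] and [group_inverseK]), and it is
    natural in maps commuting with T ([group_inverse_comm]).  Then
    beta = [group_inverse] B is defined on all polynomials, where it is a
    homotopy between 0 and the projection N [group_inverse] onto the range;
    its restriction to the range is the contraction. *)

Lemma sub_linear_sub {k : pzRingType} {V : lmodType k}
    (T : {linear V -> V}) (x y : V) :
  ((x - y) - T (x - y) = (x - T x) - (y - T y))%R.
Proof. by rewrite linearB [in LHS]opprD [LHS]addrACA -opprD. Qed.

Section GroupInverse.

Context {k : pzRingType} {V : lmodType k} {T : {linear V -> V}}.
Hypothesis dec : ker_ran_decomposition T.

Local Open Scope ring_scope.

Lemma in_ran_sqr_eq0 (x : V) :
  x \in in_ran T -> (x - T x) - T (x - T x) = 0 -> x = 0.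
Proof.
move=> xR NNx0; apply: (proj2 dec) => //; apply: (proj2 dec) => //.
by apply/in_ranP; exists x.
Qed.

(** 1 - T vanishes on the kernel part of any vector, so 1 - T maps its range
    onto itself; hence z can be found by splitting twice. *)
Lemma group_inverse_exists (x : V) : exists z : V,
  z \in in_ran T /\ (z - T z) - T (z - T z) = x - T x.
Proof.
have [y [z [-> Ny0 /in_ranP[w ->]]]] := proj1 dec x.
have [y' [z' [-> Ny'0 z'R]]] := proj1 dec w.
exists z'; split=> //.
have -> : y' + z' - T (y' + z') = z' - T z'.
  by rewrite linearD opprD addrACA Ny'0 add0r.
by rewrite [in RHS]linearD opprD [RHS]addrACA Ny0 add0r.
Qed.

Definition group_inverse_fun (x : V) : V :=
  projT1 (cid (group_inverse_exists x)).

Lemma group_inverse_fun_ran x : group_inverse_fun x \in in_ran T.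
Proof. by rewrite /group_inverse_fun; case: cid => z []. Qed.

Lemma group_inverse_funK x :
  (group_inverse_fun x - T (group_inverse_fun x))
    - T (group_inverse_fun x - T (group_inverse_fun x)) = x - T x.
Proof. by rewrite /group_inverse_fun; case: cid => z []. Qed.

Lemma group_inverse_fun_eq (x z : V) : z \in in_ran T ->
  (z - T z) - T (z - T z) = x - T x -> group_inverse_fun x = z.
Proof.
move=> zR NNz; apply/eqP; rewrite -subr_eq0; apply/eqP.
apply: in_ran_sqr_eq0; first by rewrite rpredB ?group_inverse_fun_ran.
rewrite (sub_linear_sub T _ z) (sub_linear_sub T _ (z - T z)).
by rewrite group_inverse_funK NNz subrr.
Qed.

Fact group_inverse_linear : linear group_inverse_fun.
Proof.
move=> a x y; apply: group_inverse_fun_eq.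
  by rewrite rpredD ?rpredZ ?group_inverse_fun_ran.
have linN (u v : V) :
    (a *: u + v) - T (a *: u + v) = a *: (u - T u) + (v - T v).
  by rewrite linearP opprD addrACA -scalerBr.
by rewrite !linN !group_inverse_funK.
Qed.

HB.instance Definition _ :=
  GRing.isLinear.Build k V V *:%R group_inverse_fun group_inverse_linear.

Definition group_inverse : {linear V -> V} := group_inverse_fun.

Lemma group_inverse_ran x : group_inverse x \in in_ran T.
Proof. exact: group_inverse_fun_ran. Qed.

Lemma group_inverseK x :
  (group_inverse x - T (group_inverse x))
    - T (group_inverse x - T (group_inverse x)) = x - T x.
Proof. exact: group_inverse_funK. Qed.

(** Both conditions together say that [z] is the group inverse of 1 - T at
    [x]: the second fixes the value modulo the kernel of (1 - T)^2, which is
    that of 1 - T, and the first picks the representative in the range. *)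
Lemma group_inverse_eq (x z : V) : z \in in_ran T ->
  (z - T z) - T (z - T z) = x - T x -> group_inverse x = z.
Proof. exact: group_inverse_fun_eq. Qed.

Lemma group_inverse_sub x : x \in in_ran T -> group_inverse (x - T x) = x.
Proof. by move=> xR; apply: group_inverse_eq. Qed.

End GroupInverse.

Arguments group_inverse {k V T} dec.

(** The group inverse is determined by T alone, so it inherits every
    intertwining relation of T. *)
Lemma group_inverse_comm {k : pzRingType} {U V : lmodType k}
    {TU : {linear U -> U}} {TV : {linear V -> V}}
    (decU : ker_ran_decomposition TU) (decV : ker_ran_decomposition TV)
    (f : {linear U -> V}) (fT : forall x, f (TU x) = TV (f x)) (x : U) :
  f (group_inverse decU x) = group_inverse decV (f x).
Proof.
apply/esym/group_inverse_eq.
  have /in_ranP[y ->] := group_inverse_ran decU x.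
  by apply/in_ranP; exists (f y); rewrite linearB fT.
by rewrite -!(fT, linearB) group_inverseK.
Qed.

Fact degS_inj p n m : (n.+1 + p.*2)%N = m.+1 -> (n + p.*2)%N = m.
Proof. exact: succn_inj. Qed.

Arguments degS_inj {p n m}.

Section Contraction.

Context {k : pzRingType} {C : parachain k}.
Hypothesis qC : quasi_mixed C.

Local Open Scope ring_scope.

Local Notation b := (parachain_b C).
Local Notation B := (parachain_B C).
Local Notation T := (parachain_T b B).
Local Notation G n := (group_inverse (qC n)).

(** In the clause for 0, N^-1 B would take its argument from degree -1. *)
Definition nat_beta_fun m (x : nat_mod C m) : nat_mod C m.+1 := fun p n =>
  match n return (n + p.*2)%N = m.+1 -> C n with
  | 0 => fun e => 0
  | n'.+1 => fun e => G n'.+1 (B n' (x p n' (degS_inj e)))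
  end.

Fact nat_beta_linear m : linear (@nat_beta_fun m).
Proof.
move=> a x y; apply/u_polyP => p [|n] e; rewrite u_polyDE u_polyZE /=.
  by rewrite scaler0 addr0.
by rewrite u_polyDE u_polyZE !linearP.
Qed.

HB.instance Definition _ m := GRing.isLinear.Build k (nat_mod C m)
  (nat_mod C m.+1) *:%R (@nat_beta_fun m) (@nat_beta_linear m).

Definition nat_beta m : {linear nat_mod C m -> nat_mod C m.+1} :=
  @nat_beta_fun m.

Lemma nat_beta_T m x : nat_beta m (nat_T C m x) = nat_T C m.+1 (nat_beta m x).
Proof.
apply/u_polyP => p [|n] e.
  by rewrite [RHS](linear0 (T 0)).
rewrite [LHS]/= /nat_T_fun parachain_BT.
by rewrite -(group_inverse_comm (qC n.+1) (qC n.+1) (T n.+1)).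
Qed.

Lemma nat_beta_S0 (x : nat_mod C 1) : nat_S C 0 (nat_beta 1 x) = 0.
Proof.
(* The total degree n + 2p = 0 leaves only the coefficient in C 0. *)
by apply/u_polyP => p [|n] e.
Qed.

Lemma nat_beta_S m (x : nat_mod C m.+2) :
  nat_S C m.+1 (nat_beta m.+2 x) = nat_beta m (nat_S C m x).
Proof.
apply/u_polyP => p [|n] e //=.
rewrite /nat_S_fun /=.
by rewrite (eq_irrelevance (degS_inj (degU e)) (degU (degS_inj e))).
Qed.

Lemma subT0 (x : C 0) : x - T 0 x = b 0 (B 0 x).
Proof. exact: subKr. Qed.

Lemma subTS n (x : C n.+1) : x - T n.+1 x = b n.+1 (B n.+1 x) + B n (b n x).
Proof. exact: subKr. Qed.

Lemma b_group_inverse n (x : C n.+1) : b n (G n.+1 x) = G n (b n x).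
Proof. by apply: group_inverse_comm; apply: parachain_bT. Qed.

Lemma B_group_inverse n (x : C n) : B n (G n x) = G n.+1 (B n x).
Proof. by apply: group_inverse_comm; apply: parachain_BT. Qed.

Lemma nat_beta_homotopy0 (x : nat_mod C 0) p n e :
  nat_d C 0 (nat_beta 0 x) p n e = G n (x p n e - T n (x p n e)).
Proof.
case: n e => [|n] e //.
by rewrite subT0 /= b_group_inverse (eq_irrelevance (degS_inj (degS e)) e).
Qed.

(** The right-hand side is the coefficient of the projection of x onto the
    range, because N^-1 N is 0 on ker N and 1 on the range. *)
Lemma nat_beta_homotopy m (x : nat_mod C m.+1) p n e :
  (nat_d C m.+1 (nat_beta m.+1 x) + nat_beta m (nat_d C m x)) p n e =
  G n (x p n e - T n (x p n e)).
Proof.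
rewrite u_polyDE; case: n e => [|n] e.
  rewrite subT0 /= b_group_inverse addr0.
  by rewrite (eq_irrelevance (degS_inj (degS e)) e).
(* The u^-1 part of d beta vanishes: B N^-1 B = N^-1 B^2 = 0. *)
have BGB0 : forall e', B n (nat_beta m.+1 x p.+1 n e') = 0.
  case: n {e} => [|n] e'; first by rewrite linear0.
  by rewrite /= B_group_inverse parachain_BB linear0.
rewrite subTS linearD [X in X + _]/= BGB0 addr0 b_group_inverse.
rewrite (eq_irrelevance (degS_inj (degS e)) e); congr (_ + _).
case: n e {BGB0} => [|n] e /=; rewrite ?linearD /= ?parachain_BB ?linear0 ?addr0;
  by rewrite (eq_irrelevance (degS (degS_inj e)) e).
Qed.

Lemma natural_ran_coef m (x : nat_mod C m) p n e :
  x \in in_ran (nat_T C m) -> x p n e \in in_ran (T n).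
Proof. by case/in_ranP=> y ->; apply/in_ranP; exists (y p n e). Qed.

Lemma natural_ran_contractible : S_contractible (ran_paraS (natural C)).
Proof.
exists (fun m => ran_map (nat_beta_T m)); split.
- split=> [x|m x]; apply: val_inj => /=; first exact: nat_beta_S0.
  exact: nat_beta_S.
- by move=> m x; apply: val_inj => /=; rewrite nat_beta_T.
split=> [x|m x]; apply: val_inj; apply/u_polyP => p n e.
  apply: etrans (nat_beta_homotopy0 (val x) p n e) _.
  apply: group_inverse_sub.
  by apply: natural_ran_coef (valP x).
apply: etrans (nat_beta_homotopy _ (val x) p n e) _.
apply: group_inverse_sub.
by apply: natural_ran_coef (valP x).
Qed.

Lemma natural_decomposition m : ker_ran_decomposition (nat_T C m).
Proof.
split=> [x|x Nx0 /in_ranP[y xE]].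
  (* N N^-1 projects onto the range. *)
  pose w : nat_mod C m := fun p n e => G n (x p n e).
  exists (x - (w - nat_T C m w)), (w - nat_T C m w); split.
  - by rewrite subrK.
  - apply/u_polyP => p n e; rewrite -[LHS]/(
      (x p n e - (w p n e - T n (w p n e)))
      - T n (x p n e - (w p n e - T n (w p n e)))).
    by rewrite sub_linear_sub group_inverseK subrr.
  by apply/in_ranP; exists w.
apply/u_polyP => p n e; apply: (proj2 (qC n)).
  by rewrite -[LHS]/((x - nat_T C m x) p n e) Nx0.
by apply: natural_ran_coef; apply/in_ranP; exists y.
Qed.

End Contraction.

Theorem proposition3p7 (k : pzRingType) (C : parachain k) :
  quasi_mixed C -> quasi_S (natural C).
Proof.
move=> qC; split; first exact: natural_ran_contractible.
exact: natural_decomposition.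
Qed.
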